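(* For the dynamic assortment problem described in the context, no online algorithm can achieve a competitive ratio higher than $0.5$: for every $\alpha>0.5$, no online algorithm is $\alpha$-competitive.
   Context: **Model.** An instance consists of the following. The horizon is $[0,1]$. There are $L$ resources, $N$ products and $K$ customer types ($L,N,K$ arbitrary). Resource $l$ has initial integer capacity $C_l$ and an expiration time $t_l$. Product $n\in\{1,\dots,N\}$ uses one unit of a single resource $l_n$ and earns reward $r_n$; $N_l=\{n:l_n=l\}$. Product $0$ is the no-purchase option, $r_0=0$. An assortment is a subset of $\{0,1,\dots,N\}$ containing $0$. Type-$k$ customers arrive according to independent non-homogeneous Poisson processes with integrable rates $\lambda_k(t)\ge0$, $t\in[0,1]$. A type-$k$ customer offered $S$ chooses exactly one $n\in S$, product $n$ with probability $P^k(n,S)$ ($\sum_{n\in S}P^k(n,S)=1$), independently of everything else given type and offered assortment; the choice model is otherwise arbitrary and may differ by type. Types are defined so that if type $k$ can arrive after time $t_l$, then $P^k(n,S)=0$ for all $n\in N_l$ and $S\ni n$. If $n\ge1$ is chosen, $r_n$ is earned and the inventory of resource $l_n$ drops by one. **Policies.** Upon each arrival, whose type is observed, a policy offers an assortment (possibly random) that contains no product whose resource has zero remaining inventory. An *online* policy bases its decision at time $t$ only on the instance data (including the known rates $\lambda_k(\cdot)$ over the whole horizon) and on what has been observed up to time $t$. An *offline* policy additionally knows at time $0$ the full realization of the arrivals (times and types of all customers over the horizon), but not the customers' random choices. $V^{\Pi}(C,0)$ is the expected total reward of online policy $\Pi$ from initial inventory $C=(C_1,\dots,C_L)$, and $V^{OFF}$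 is the optimal expected total reward over offline policies. **Competitive ratio.** An online algorithm (assigning to each instance an online policy $\Pi$) is *$\alpha$-competitive* if $V^\Pi(C,0)\ge\alpha V^{OFF}$ for every instance, i.e. for all values of the rewards, choice-model parameters, arrival rates and capacities. *)

(* Defs.v *)
From HB Require Import structures.
From mathcomp Require Import all_boot all_order all_algebra.
From mathcomp Require Import all_classical all_reals all_analysis.

Set Implicit Arguments.
Unset Strict Implicit.
Unset Printing Implicit Defensive.

Import Order.TTheory GRing.Theory Num.Theory.
Import numFieldNormedType.Exports.

Local Open Scope classical_set_scope.
Local Open Scope ring_scope.

(* The alternatives are [option 'I_N]: [Some n] is a product and [None] is the
   no-purchase option.  An assortment is a set of alternatives containing
   [None]; the requirement [None \in S] is stated wherever it matters. *)
Notation alternative N := (option 'I_N).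
Notation assortment N := {set option 'I_N}.

Record instance (R : realType) := Instance {
  nres : nat;
  nprod : nat;
  ntype : nat;
  capacity : 'I_nres -> nat;
  expiration : 'I_nres -> R;
  resource : 'I_nprod -> 'I_nres;
  reward : 'I_nprod -> R;
  rate : 'I_ntype -> R -> R;
  (* [choice_prob k S n] is P^k(n, S); only the values with [None \in S] and
     [n \in S] are constrained or used. *)
  choice_prob : 'I_ntype -> assortment nprod -> alternative nprod -> R;
  reward_ge0 : forall n, 0 <= reward n;
  rate_ge0 : forall k (t : R), 0 <= t <= 1 -> 0 <= rate k t;
  rate_integrable : forall k,
    (@lebesgue_measure R).-integrable `[0, 1] (fun t => (rate k t)%:E);
  choice_prob_ge0 : forall k (S : assortment nprod) n,
    None \in S -> n \in S -> 0 <= choice_prob k S n;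
  choice_prob_sum1 : forall k (S : assortment nprod),
    None \in S -> \sum_(n in S) choice_prob k S n = 1;
  (* "Type k can arrive after t_l": its expected number of arrivals in
     ]t_l, 1] is positive. *)
  choice_prob_expired : forall k l,
    0 < \int[@lebesgue_measure R]_(t in `[0, 1] `&` `]expiration l, +oo[)
          rate k t ->
    forall n (S : assortment nprod),
      resource n = l -> None \in S -> Some n \in S ->
      choice_prob k S (Some n) = 0
}.

(* A realization of the arrivals: the (time, type) pairs in order of arrival. *)
Notation arrivals R I := (seq (Real.sort R * 'I_(@ntype R I))).

(* The assortments offered to the successive customers and their choices. *)
Notation outcomes I := (seq (assortment (nprod I) * alternative (nprod I))).

Section Arrivals.
Context (R : realType) (I : instance R).

Definition nb_arrivals (k : 'I_(ntype I)) (s t : R)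
    (w : arrivals R I) : nat :=
  count (fun x => (x.2 == k) && (s < x.1 <= t)) w.

(* The library's [poisson_pmf] is not used because it is 1 everywhere when the
   mean is 0. *)
Definition poisson_mass (mean : R) (c : nat) : R :=
  mean ^+ c / c`!%:R * expR (- mean).

(* [arr] realizes on (Omega, P) the superposition of independent
   non-homogeneous Poisson processes on ]0, 1] with rates [rate I k].  The last
   field expresses both that each process has independent increments and that
   the processes of the different types are independent of each other. *)
Record poisson_arrivals d (Omega : measurableType d) (P : probability Omega R)
    (arr : Omega -> arrivals R I) : Prop := PoissonArrivals {
  arr_horizon : forall omega, all (fun x : R * 'I_(ntype I) => 0 < x.1 <= 1) (arr omega);
  arr_sorted : forall omega, sorted <=%R (map fst (arr omega));
  arr_measurable : forall (ks : seq 'I_(ntype I))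
      (A : set ((size ks).-tuple (measurableTypeR R))),
    measurable A ->
    measurable [set omega | exists2 t, A t & arr omega = zip t ks];
  arr_poisson : forall k (s t : R) (c : nat), 0 <= s -> s <= t -> t <= 1 ->
    P [set omega | nb_arrivals k s t (arr omega) = c] =
    (poisson_mass (\int[@lebesgue_measure R]_(u in `]s, t]) rate k u) c)%:E;
  arr_independent : forall (m : nat) (t : nat -> R)
      (c : 'I_(ntype I) -> 'I_m -> nat),
    0 <= t 0%N -> (forall i, (i < m)%N -> t i <= t i.+1) -> t m <= 1 ->
    P [set omega | forall k (i : 'I_m),
         nb_arrivals k (t i) (t i.+1) (arr omega) = c k i] =
    (\prod_k \prod_(i < m)
       P [set omega | nb_arrivals k (t i) (t i.+1) (arr omega) = c k i])%E
}.

End Arrivals.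

Section Policies.
Context (R : realType) (I : instance R).

Definition remaining (h : outcomes I) (l : 'I_(nres I)) : nat :=
  capacity l -
  count (fun x => if x.2 is Some n then resource n == l else false) h.

Definition feasible (h : outcomes I) (S : assortment (nprod I)) : bool :=
  (None \in S) &&
  [forall n, (Some n \in S) ==> (0 < remaining h (resource n))%N].

(* [q w h S] is the conditional probability of offering S to customer number
   [size h] (counting from 0), when the arrivals over the whole horizon are w
   and the offers and choices of the previous customers are h. *)
Definition decision_rule :=
  arrivals R I -> outcomes I -> assortment (nprod I) -> R.

Record is_policy (q : decision_rule) : Prop := IsPolicy {
  policy_ge0 : forall w h S, 0 <= q w h S;
  policy_sum1 : forall w h, \sum_S q w h S = 1;
  policy_feasible : forall w h S, q w h S != 0 -> feasible h S;
  policy_measurable : forall (ks : seq 'I_(ntype I)) h S,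
    measurable_fun [set: (size ks).-tuple (measurableTypeR R)]
      (fun t : (size ks).-tuple (measurableTypeR R) => q (zip t ks) h S)
}.

(* The decision for customer number [size h] only uses the times and types of
   the arrivals up to and including that customer. *)
Definition nonanticipating (q : decision_rule) : Prop :=
  forall w w' h S, take (size h).+1 w = take (size h).+1 w' ->
    q w h S = q w' h S.

Definition offline_policy := {q : decision_rule | is_policy q}.

Definition online_policy :=
  {q : decision_rule | is_policy q /\ nonanticipating q}.

Definition reward_of (n : alternative (nprod I)) : R :=
  if n is Some n' then reward n' else 0.

(* Expected reward from the customers in u, the last ones of the arrivals w,
   after the outcomes h; the expectation is over the offers and the choices. *)
Fixpoint reward_to_go (q : decision_rule) (w : arrivals R I)
    (h : outcomes I) (u : arrivals R I) : R :=
  if u is x :: u' then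
    \sum_S q w h S * \sum_(n in S) choice_prob x.2 S n *
      (reward_of n + reward_to_go q w (rcons h (S, n)) u')
  else 0.

Definition total_reward (q : decision_rule) (w : arrivals R I) : R :=
  reward_to_go q w [::] w.

Definition value d (Omega : measurableType d) (P : probability Omega R)
    (arr : Omega -> arrivals R I) (q : decision_rule) : \bar R :=
  (\int[P]_omega (total_reward q (arr omega))%:E)%E.

Definition value_offline d (Omega : measurableType d) (P : probability Omega R)
    (arr : Omega -> arrivals R I) : \bar R :=
  ereal_sup [set value P arr (sval q) | q in [set: offline_policy]].

End Policies.

Definition online_algorithm (R : realType) :=
  forall I : instance R, online_policy I.

(* Values only depend on the law of the arrivals, so ranging over all their
   realizations amounts to ranging over all instances. *)
Definition competitive (R : realType) (alpha : R) (A : online_algorithm R)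
    : Prop :=
  forall (I : instance R) (d : measure_display) (Omega : measurableType d)
    (P : probability Omega R) (arr : Omega -> arrivals R I),
    poisson_arrivals P arr ->
    (alpha%:E * value_offline P arr <= value P arr (sval (A I)))%E.

(* Main.v *)
Require Import Defs.
From HB Require Import structures.
From mathcomp Require Import all_boot all_order all_algebra.
From mathcomp Require Import all_classical all_reals all_analysis.
From mathcomp Require Import measurable_realfun.
From mathcomp Require Import ring lra.
Import Order.TTheory GRing.Theory Num.Theory.
Import numFieldNormedType.Exports.
Local Open Scope classical_set_scope.
Local Open Scope ring_scope.

(** One unit of a single resource can be sold to customers of two types, each
    interested in its own product only. The early customers, arriving in
    [1/4, 1/2], pay 1 and are present with probability [1 - delta]; the late
    ones, arriving in [3/4, 1], pay [1 / delta] and are present with probability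
    [delta]. An online policy that still holds the unit after the early window
    can expect at most [delta * (1 / delta) = 1] from it, so its value is at most
    1 however it treats the early customers. Knowing the arrivals, one sells to
    a late customer if there is one and to an early one otherwise, which is worth
    [1 + (1 - delta)^2]; this tends to 2 as [delta] tends to 0.

    The Poisson process of each window is realized as a Poisson number of i.i.d.
    uniform points, sorted. The counts of n such points are multinomial by
    induction on n, so that the counts of disjoint sets are independent Poisson
    variables. *)

Set Implicit Arguments.
Unset Strict Implicit.
Unset Printing Implicit Defensive.

(** * Poisson point processes *)

Section IidTuples.
Context d (T : measurableType d) (R : realType).

Definition cons_pair n (x : T * n.-tuple T) : n.+1.-tuple T :=
  [tuple of x.1 :: x.2].

Lemma measurable_cons_pair n : measurable_fun setT (@cons_pair n).
Proof. exact: measurable_cons. Qed.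

HB.instance Definition _ n :=
  isMeasurableFun.Build _ _ _ _ (@cons_pair n) (@measurable_cons_pair n).

Variable P : probability T R.

(** The product measure of [n] copies of [P]. Adding each new coordinate at the head lets inductions
    on [n] condition on the first point. *)
Fixpoint iid_law n : probability (n.-tuple T) R :=
  if n is n'.+1 then distribution (P \x iid_law n')%E (@cons_pair n')
  else \d_([tuple] : 0.-tuple T).

End IidTuples.

(* A copy of [seq T], measurable with the largest sigma-algebra that makes the
   inclusions of all the [n.-tuple T] measurable. *)
Definition seqm (T : Type) := seq T.
Definition seq_display : measure_display -> measure_display.
Proof. exact. Qed.

Section SeqMeasurable.
Context d (T : measurableType d).
HB.instance Definition _ := Choice.on (seqm T).
HB.instance Definition _ := isPointed.Build (seqm T) [::].

Definition seq_measurable (A : set (seqm T)) :=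
  forall n, measurable [set t : n.-tuple T | A t].

Let seq_set0 : seq_measurable set0.
Proof. by move=> n; exact: measurable0. Qed.

Let seq_setC A : seq_measurable A -> seq_measurable (~` A).
Proof. by move=> mA n; exact: (measurableC (mA n)). Qed.

Let seq_bigcup (F : _^nat) : (forall i, seq_measurable (F i)) ->
  seq_measurable (\bigcup_i (F i)).
Proof.
move=> mF n; rewrite [X in measurable X](_ : _ =
  \bigcup_i [set t : n.-tuple T | F i t]); last by [].
by apply: bigcup_measurable => i _; exact: mF.
Qed.

HB.instance Definition _ := @isMeasurable.Build (seq_display d)
  (seqm T) seq_measurable seq_set0 seq_setC seq_bigcup.
End SeqMeasurable.

Lemma seq_measurableP d (T : measurableType d) (A : set (seqm T)) :
  (forall n, measurable [set t : n.-tuple T | A t]) -> measurable A.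
Proof. by []. Qed.

Lemma measurable_forall d (T : measurableType d) (K : finType) (F : K -> set T) :
  (forall k, measurable (F k)) -> measurable [set x | forall k, F k x].
Proof.
move=> mF; rewrite (_ : [set x | _] = \bigcap_(k in [set: K]) F k); last first.
  by apply/seteqP; split=> x /= Fx k; [move=> _|]; exact: Fx.
by apply: fin_bigcap_measurable => //; exact: finite_finset.
Qed.

Section SeqMeasurableTheory.
Context d (T : measurableType d).

Definition seq_of_tuple n (t : n.-tuple T) : seqm T := t.

Lemma measurable_seq_of_tuple n : measurable_fun setT (@seq_of_tuple n).
Proof. by move=> _ A mA; rewrite setTI; exact: mA. Qed.

HB.instance Definition _ n :=
  isMeasurableFun.Build _ _ _ _ (@seq_of_tuple n) (@measurable_seq_of_tuple n).

(** On tuples of a fixed length, by induction on the length, according to whether the head satisfies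
    [a]. *)
Lemma measurable_count (a : pred T) (c : nat) :
  measurable [set x | a x] -> measurable [set s : seqm T | count a s = c].
Proof.
move=> ma; apply: seq_measurableP => n; elim: n c => [|n IH] c.
  have -> : [set t : 0.-tuple T | [set s : seqm T | count a s = c] t] =
      [set _ | (0 == c)%N].
    by apply/seteqP; split=> t /=; rewrite tuple0 /= => /eqP.
  by case: (0 == c)%N; rewrite ?set_true ?set_false;
    [exact: measurableT|exact: measurable0].
have mh : measurable [set t : n.+1.-tuple T | a (thead t)].
  by have := @measurable_tnth _ T n.+1 ord0 measurableT _ ma; rewrite setTI.
have mb e : measurable [set t : n.+1.-tuple T | count a (behead t) = e].
  by have := @measurable_behead _ T n measurableT _ (IH e); rewrite setTI.
have -> : [set t : n.+1.-tuple T | [set s : seqm T | count a s = c] t] =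
  ([set t : n.+1.-tuple T | a (thead t)] `&`
   [set t : n.+1.-tuple T | if c is c'.+1 then count a (behead t) = c' else False]) `|`
  (~` [set t : n.+1.-tuple T | a (thead t)] `&`
   [set t : n.+1.-tuple T | count a (behead t) = c]).
  apply/seteqP; split=> t /=; rewrite [in count a t](tuple_eta t) /=.
    case: (a (thead t)) => /=; last by rewrite add0n => ->; right.
    by rewrite add1n => <-; left.
  by move=> [[-> +]|[/negP/negbTE -> ->]]; [case: c => // c ->|].
apply: measurableU; apply: measurableI => //; last exact: measurableC.
case: c => [|c]; [exact: measurable0|exact: mb].
Qed.

End SeqMeasurableTheory.

Lemma measure_partition d (T : measurableType d) (R : realType)
    (mu : {measure set T -> \bar R}) (K : finType) (F : K -> set T) :
  (forall k, measurable (F k)) -> trivIset setT F ->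
  (mu (\bigcup_k F k) = \sum_k mu (F k))%E.
Proof.
move=> mF tF; rewrite measure_fin_bigcup//; last exact: finite_finset.
rewrite [RHS]fsbig_seq ?index_enum_uniq//; apply: eq_fsbigl.
by apply/seteqP; split=> k //= _; rewrite mem_index_enum.
Qed.

Lemma poisson_mass_ge0 (R : realType) (mu : R) n :
  0 <= mu -> 0 <= poisson_mass mu n.
Proof. by move=> mu0; rewrite mulr_ge0 ?expR_ge0// divr_ge0// exprn_ge0. Qed.

Lemma poisson_mass_sum1 (R : realType) (mu : R) : 0 <= mu ->
  (\sum_(n <oo) (poisson_mass mu n)%:E = 1)%E.
Proof.
move=> mu0; under eq_eseriesr do rewrite /poisson_mass mulrC EFinM.
rewrite nneseriesZl/=; last first.
  by move=> n _; rewrite lee_fin divr_ge0// exprn_ge0.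
rewrite -[RHS](_ : ((expR (- mu))%:E * (expR mu)%:E)%E = _); last first.
  by rewrite -EFinM expRN mulVf ?gt_eqF ?expR_gt0.
congr *%E; rewrite expRE -EFin_lim; last first.
  rewrite /pseries/=; under eq_fun do rewrite mulrC.
  exact: is_cvg_series_exp_coeff.
apply/congr_lim/funext => n/=; rewrite /pseries/= /series/= -sumEFin//.
by under eq_bigr do rewrite mulrC.
Qed.

(** * Multinomial counts of i.i.d. points *)

Section Counts.
Context d (T : measurableType d) (R : realType) (P : probability T R).
Variables (K : finType) (lab : T -> K).
Hypothesis mlab : forall k, measurable (lab @^-1` [set k]).

Let p k := fine (P (lab @^-1` [set k])).

Definition counts_are (c : K -> nat) (s : seq T) : Prop :=
  forall k, count (fun x => lab x == k) s = c k.

Lemma measurable_counts_are c : measurable (counts_are c : set (seqm T)).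
Proof.
apply: measurable_forall => k; apply: measurable_count.
rewrite (_ : [set x | _] = lab @^-1` [set k])//.
by apply/seteqP; split=> x /= /eqP.
Qed.

(** The contribution of a first point labelled [k]. Summed over [k], the factors [c k] add up to the
    number of points, which turns [n!] into [(n+1)!] in the multinomial formula. *)
Lemma multinomial_step (c : K -> nat) k : (0 < c k)%N ->
  p k * \prod_j (p j ^+ (c j - (j == k)) / (c j - (j == k))`!%:R) =
  (c k)%:R * \prod_j (p j ^+ c j / (c j)`!%:R).
Proof.
move=> ck; rewrite (bigD1 k)//= [in RHS](bigD1 k)//= !mulrA eqxx subn1.
congr (_ * _); last first.
  by apply: eq_bigr => j /negbTE ->; rewrite subn0.
case: (c k) ck => // m _; rewrite /= factS natrM exprS.
have := pnatr_eq0 R m`!; rewrite gtn_eqF ?fact_gt0// => /negbT.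
have := pnatr_eq0 R m.+1 => /= /negbT.
by move=> *; field; apply/andP.
Qed.

Lemma iid_law_counts n (c : K -> nat) :
  iid_law P n [set t : n.-tuple T | counts_are c t] =
  (if (\sum_k c k == n)%N then n`!%:R * \prod_k (p k ^+ c k / (c k)`!%:R)
   else 0)%:E.
Proof.
elim: n c => [|n IH] c.
  rewrite /= diracE sum_nat_eq0; case: ifPn => [/forallP c0|].
    rewrite mem_set/=; last by move=> k; rewrite /= (eqP (c0 k)).
    by rewrite fact0 mul1r big1// => k _; rewrite (eqP (c0 k)) expr0 fact0 divr1.
  move=> /forallPn[k ck]; rewrite memNset//= => /(_ k) /= ck0.
  by move: ck; rewrite -ck0.
(* The event left to the last [n] points when the first is labelled [k]. The condition [0 < c k] is
   explicit because truncated subtraction would leave [c k = 0] unchanged. *)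
pose G k := [set t : n.-tuple T |
  (0 < c k)%N /\ counts_are (fun j => c j - (j == k))%N t].
have mG k : measurable (G k).
  rewrite /G; case: (0 < c k)%N; last first.
    by rewrite (_ : [set _ | _] = set0)//; apply/seteqP; split=> t //= [].
  rewrite (_ : [set _ | _] =
      [set t : n.-tuple T | counts_are (fun j => c j - (j == k))%N t]).
    exact: measurable_counts_are.
  by apply/seteqP; split=> t //= [].
rewrite /= /distribution /pushforward.
rewrite [X in product_measure1 _ _ X](_ : _ =
    \bigcup_k ((lab @^-1` [set k]) `*` G k)); last first.
  apply/seteqP; split=> -[x t] /=.
    move=> xt; exists (lab x) => //=; split=> //; split=> [|j].
      by have := xt (lab x); rewrite /= eqxx add1n => <-.
    by have := xt j; rewrite /= eq_sym => <-; rewrite addKn.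
  move=> [k _ [/= xk [ck tk]]] j; rewrite /= tk xk eq_sym subnKC//.
  by case: eqP => // ->.
rewrite measure_partition; last 2 first.
- by move=> k; apply: measurableX.
- apply/trivIsetP => k j _ _ kj; apply/seteqP; split=> -[x t] //=.
  by move=> [[/= -> _] [/= e _]]; rewrite e eqxx in kj.
(* Each label of the first point contributes [c k] times a factor independent of [k]. *)
transitivity (\sum_k ((if (\sum_k c k == n.+1)%N then
    n`!%:R * ((c k)%:R * \prod_k (p k ^+ c k / (c k)`!%:R)) else 0)%:E : \bar R))%E.
  apply: eq_bigr => k _.
  rewrite [LHS](_ : _ = (P (lab @^-1` [set k]) * iid_law P n (G k))%E); last first.
    exact: product_measure1E.
  rewrite -[P _]fineK ?fin_num_measure// -/(p k).
  have [ck|ck] := posnP (c k).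
    rewrite [G k](_ : _ = set0) ?measure0 ?mule0; last first.
      by apply/seteqP; split=> t //= []; rewrite ck.
    by rewrite ck !(mul0r,mulr0) if_same.
  rewrite [G k](_ : _ =
      [set t : n.-tuple T | counts_are (fun j => c j - (j == k))%N t]); last first.
    by apply/seteqP; split=> t //= [].
  rewrite IH -EFinM; congr EFin.
  have -> : (\sum_j (c j - (j == k)) == n)%N = (\sum_k c k == n.+1)%N.
    rewrite (bigD1 k)//= [in RHS](bigD1 k)//= eqxx subn1.
    rewrite [X in (_ + X == n)%N](_ : _ = \sum_(i | i != k) c i)%N; last first.
      by apply: eq_bigr => j /negbTE ->; rewrite subn0.
    by case: (c k) ck => //= m _; rewrite addSn eqSS.
  by case: ifP => _; rewrite ?mulr0// mulrCA multinomial_step.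
rewrite sumEFin; congr EFin; case: eqP => [cn|_]; last by rewrite big1.
by rewrite -big_distrr/= -big_distrl/= -natr_sum cn mulrA -natrM mulnC -factS.
Qed.

Lemma label_prob_sum1 : \sum_k p k = 1.
Proof.
apply: EFin_inj; rewrite -sumEFin.
under eq_bigr do rewrite fineK ?fin_num_measure//.
rewrite -measure_partition//.
  rewrite (_ : \bigcup_k _ = setT); first exact: probability_setT.
  by apply/seteqP; split=> x //= _; exists (lab x).
apply/trivIsetP => k j _ _ kj; apply/seteqP; split=> x //= [-> e].
by rewrite e eqxx in kj.
Qed.

End Counts.

(** * A Poisson number of i.i.d. points *)

Section PoissonLaw.
Context d (T : measurableType d) (R : realType) (P : probability T R).
Variables (mu : R) (mu0 : 0 <= mu).

(** The law of a Poisson point process with intensity measure [mu * P], as a mixture over the number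
    [n] of points. *)
Definition poisson_law : set (seqm T) -> \bar R :=
  mseries (fun n => mscale (NngNum (poisson_mass_ge0 n mu0))
    (distribution (iid_law P n) (@seq_of_tuple _ T n))) 0.

HB.instance Definition _ := Measure.on poisson_law.

Lemma poisson_lawE A : poisson_law A =
  (\sum_(n <oo) (poisson_mass mu n)%:E * iid_law P n [set t : n.-tuple T | A t])%E.
Proof. by []. Qed.

Let poisson_law_setT : poisson_law setT = 1%E.
Proof.
rewrite poisson_lawE -(poisson_mass_sum1 mu0); apply: eq_eseriesr => n _.
by rewrite (_ : [set t : n.-tuple T | _] = setT)// probability_setT mule1.
Qed.

HB.instance Definition _ := Measure_isProbability.Build _ _ _
  poisson_law poisson_law_setT.

(** Counts of total [N] occur only in samples of size [N], so a single term of the series survives.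
    Its [N!] cancels against the Poisson mass; [mu ^+ N] factors over the labels because the counts
    sum to [N], and [expR (- mu)] because the label probabilities sum to 1. *)
Lemma poisson_law_counts (K : finType) (lab : T -> K) (c : K -> nat) :
  (forall k, measurable (lab @^-1` [set k])) ->
  poisson_law (counts_are lab c) =
  (\prod_k poisson_mass (mu * fine (P (lab @^-1` [set k]))) (c k))%:E.
Proof.
move=> mlab; rewrite poisson_lawE.
pose N := (\sum_k c k)%N.
rewrite (@nneseriesD1 _ _ N)//; last first.
  by move=> n _; rewrite mule_ge0// lee_fin poisson_mass_ge0.
rewrite eseries0 ?adde0; last first.
  by move=> n _ /= nN; rewrite iid_law_counts// eq_sym -/N (negbTE nN) mule0.
rewrite iid_law_counts// eqxx -EFinM; congr EFin.
set p := fun k => fine (P (lab @^-1` [set k])).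
transitivity (\prod_k ((mu * p k) ^+ c k / (c k)`!%:R) *
    \prod_k expR (- (mu * p k))); last by rewrite -big_split.
rewrite -expR_sum sumrN -mulr_sumr label_prob_sum1// mulr1 /poisson_mass.
have -> : \prod_k ((mu * p k) ^+ c k / (c k)`!%:R) =
    mu ^+ N * \prod_k (p k ^+ c k / (c k)`!%:R).
  rewrite /N -prodrXr -big_split/=; apply: eq_bigr => k _.
  by rewrite exprMn mulrA.
have : N`!%:R != 0 :> R by rewrite pnatr_eq0 gtn_eqF ?fact_gt0.
by move: (\prod_k _) => q N0; field.
Qed.

(* Points outside every set [B i] are collected in one more class, whose count
   is then summed out. *)
Lemma poisson_law_disjoint_counts m (B : 'I_m -> set T) (c : 'I_m -> nat) :
  (forall i, measurable (B i)) -> trivIset setT B ->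
  poisson_law [set s | forall i, count (fun x => x \in B i) s = c i] =
  (\prod_i poisson_mass (mu * fine (P (B i))) (c i))%:E.
Proof.
(* Disjointness makes the picked index the only one possible; [None] labels the points outside every
   [B i]. *)
move=> mB tB; pose lab x : option 'I_m := [pick i | x \in B i].
have labP x i : (lab x == Some i) = (x \in B i).
  rewrite /lab; case: pickP => [j xj|->//].
  apply/eqP/idP => [[<-//]|xi]; congr Some; apply/eqP/negPn/negP => ji.
  move/trivIsetP : tB => /(_ j i I I ji) /seteqP[sub _].
  exact: (sub x (conj (set_mem xj) (set_mem xi))).
have mlab k : measurable (lab @^-1` [set k]).
  have mS i : measurable (lab @^-1` [set Some i]).
    rewrite (_ : _ @^-1` _ = B i)//; apply/seteqP; split=> x /= => [/eqP|xi].
      by rewrite labP => /set_mem.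
    by apply/eqP; rewrite labP; exact: mem_set.
  case: k => [i|]; first exact: mS.
  rewrite (_ : _ @^-1` _ = ~` (\bigcup_i (lab @^-1` [set Some i]))).
    by apply: measurableC; apply: fin_bigcup_measurable => //; exact: finite_finset.
  apply/seteqP; split=> x /=; first by move=> xN [i _ /=]; rewrite xN.
  by move=> xS; case E: (lab x) => [i|//]; case: xS; exists i.
have BE i : B i = lab @^-1` [set Some i].
  apply/seteqP; split=> x /= => [xi|/eqP].
    by apply/eqP; rewrite labP; exact: mem_set.
  by rewrite labP => /set_mem.
pose e a (k : option 'I_m) := if k is Some i then c i else a.
rewrite (_ : [set s | _] = \bigcup_a [set s : seqm T | counts_are lab (e a) s]).
  have mc a : measurable [set s : seqm T | counts_are lab (e a) s].
    exact: measurable_counts_are.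
  rewrite measure_semi_bigcup//; last 2 first.
  - apply/trivIsetP => a b _ _ ab; apply/seteqP; split=> s //= [sa sb].
    by have := sa None; rewrite (sb None)/= => ba; rewrite ba eqxx in ab.
  - exact: bigcupT_measurable.
  rewrite (eq_eseriesr (g := fun a =>
    (\prod_i poisson_mass (mu * fine (P (B i))) (c i))%:E *
    (poisson_mass (mu * fine (P (lab @^-1` [set None]))) a)%:E)%E); last first.
    move=> a _; rewrite [LHS]poisson_law_counts// -EFinM; congr EFin.
    rewrite (bigD1 None)//= mulrC; congr (_ * _).
    rewrite (reindex_omap Some id) => [|[i|]//]; apply: eq_big => [i|i _].
      by rewrite eqxx.
    by rewrite BE.
  rewrite nneseriesZl; last first.
    by move=> a _; rewrite lee_fin poisson_mass_ge0// mulr_ge0// fine_ge0.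
  by rewrite poisson_mass_sum1 ?mule1// mulr_ge0// fine_ge0.
apply/seteqP; split=> s /=.
  move=> sc; exists (count (fun x => lab x == None) s) => //= -[i|]//=.
  by rewrite -sc; apply: eq_count => x; rewrite labP.
move=> [a _ /= sa] i; rewrite -[RHS](sa (Some i)).
by apply: eq_count => x; rewrite labP.
Qed.

Lemma poisson_law_nil : poisson_law [set [::]] = (expR (- mu))%:E.
Proof.
rewrite poisson_lawE (@nneseriesD1 _ _ 0)//; last first.
  by move=> n _; rewrite mule_ge0// lee_fin poisson_mass_ge0.
rewrite eseries0 ?adde0; last first.
  case=> // n _ _; rewrite (_ : [set t : n.+1.-tuple T | _] = set0) ?measure0 ?mule0//.
  by apply/seteqP; split=> t //= /(congr1 size); rewrite size_tuple.
rewrite [X in iid_law _ _ X](_ : _ = setT) ?probability_setT ?mule1//; last first.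
  by apply/seteqP; split=> t //= _; rewrite tuple0.
by rewrite /poisson_mass expr0 fact0 divr1 mul1r.
Qed.

End PoissonLaw.

Lemma measurable_natfun_set d (T : measurableType d) (f : T -> nat) (Q : pred nat) :
  (forall n, measurable [set x | f x = n]) -> measurable [set x | Q (f x)].
Proof.
move=> mf; rewrite (_ : [set x | _] = \bigcup_(n in [set n | Q n]) [set x | f x = n]).
  by apply: bigcup_measurable => n _; exact: mf.
by apply/seteqP; split=> x /= => [Qx|[n /= + ->]//]; exists (f x).
Qed.

Lemma nth_sorted_le d (T : orderType d) (s : seq T) (x0 y : T) i :
  sorted <=%O s -> (i < size s)%N ->
  (nth x0 s i <= y)%O = (i < count (fun x => (x <= y)%O) s)%N.
Proof.
move=> ss si; case: ltnP => [lt|ge]; first exact: nth_count_le.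
by apply/negbTE; rewrite -ltNge; apply: nth_count_gt => //; rewrite ge.
Qed.

(** * Sorted times within a window *)

Section Times.
Context (R : realType) (a b : R).
Notation T := (measurableTypeR R).

Definition clamp (x : R) : R := Num.max a (Num.min b x).

Lemma clamp_itv x : a <= b -> a <= clamp x <= b.
Proof. by move=> ab; rewrite /clamp le_max lexx/= ge_max ab ge_min lexx. Qed.

Lemma clamp_id x : a <= x <= b -> clamp x = x.
Proof. by move=> /andP[ax xb]; rewrite /clamp (min_r xb) (max_r ax). Qed.

Lemma measurable_clamp : measurable_fun [set: T] (clamp : T -> T).
Proof.
apply: measurable_maxr; first exact: measurable_cst.
by apply: measurable_minr; [exact: measurable_cst|exact: measurable_id].
Qed.

(* Clamping confines the times to [a, b] for every sample, not just almost every
   one. *)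
Definition times (s : seqm T) : seq R := sort <=%R (map clamp s).

Lemma size_times s : size (times s) = size s.
Proof. by rewrite size_sort size_map. Qed.

Lemma count_times (p : pred R) s : count p (times s) = count (p \o clamp) s.
Proof. by rewrite (permP (permEl (perm_sort _ _))) count_map. Qed.

Lemma times_sorted s : sorted <=%R (times s).
Proof. exact: sort_le_sorted. Qed.

Lemma times_itv s : a <= b -> all (fun x => a <= x <= b) (times s).
Proof.
move=> ab; apply/allP => x; rewrite mem_sort => /mapP[y _ ->].
exact: clamp_itv.
Qed.

Lemma measurable_size (n : nat) : measurable [set s : seqm T | size s = n].
Proof.
rewrite (_ : [set s | _] = [set s : seqm T | count xpredT s = n]).
  by apply: measurable_count; rewrite set_true.
by apply/seteqP; split=> s /=; rewrite count_predT.
Qed.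

(* The i-th order statistic is at most y iff more than i points are. *)
Lemma measurable_nth_times i :
  measurable_fun [set: seqm T] (fun s => nth 0 (times s) i : T).
Proof.
apply: (measurability _ (RGenOInfty.measurableE R)) => _ -[_ [y ->] <-].
rewrite setTI -[X in measurable X]setCK; apply: measurableC.
(* Beyond the sample size [nth] returns its default 0, so the condition becomes [0 <= y] there. *)
rewrite (_ : ~` _ =
  ([set s : seqm T | (i < size s)%N] `&`
    [set s : seqm T | (i < count (fun x => (clamp x <= y)%R) s)%N]) `|`
  (~` [set s : seqm T | (i < size s)%N] `&` [set _ | 0 <= y])).
  have mi := measurable_natfun_set (f := fun s : seqm T => size s) (fun n => (i < n)%N)
    measurable_size.
  apply: measurableU; apply: measurableI => //.
  - apply: (measurable_natfun_set (f := fun s : seqm T => count _ s)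
      (fun n => (i < n)%N)) => n.
    apply: measurable_count; rewrite (_ : [set x | _] = clamp @^-1` `]-oo, y]).
      by rewrite -[X in measurable X]setTI; apply: measurable_clamp.
    by apply/seteqP; split=> x /=; rewrite in_itv.
  - exact: measurableC.
  - by case: (0 <= y); rewrite ?set_true ?set_false;
      [exact: measurableT|exact: measurable0].
apply/seteqP; split=> s /=; rewrite in_itv/= andbT.
  move=> /negP; rewrite -leNgt; have [si|si] := ltnP i (size s).
    by rewrite nth_sorted_le ?times_sorted ?size_times// count_times; left.
  by rewrite nth_default ?size_times//; right; split=> //; rewrite ltnNge si.
move=> siy; apply/negP; rewrite -leNgt; move: siy => [[si]|[/negP]].
  by rewrite nth_sorted_le ?times_sorted ?size_times// count_times.
by rewrite -leqNgt => si; rewrite nth_default ?size_times.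
Qed.

End Times.

(** * Merging two windows into one arrival sequence *)

Section Arr.
Context (R : realType) (a1 b1 a2 b2 : R) (K : eqType) (k1 k2 : K).
Hypothesis k12 : k1 != k2.
Notation T := (measurableTypeR R).

(** Concatenation yields a sorted sequence when the first window ends before the second begins, as
    in the hard instance. *)
Definition two_arrivals (w : seqm T * seqm T) : seq (R * K) :=
  [seq (x, k1) | x <- times a1 b1 w.1] ++ [seq (x, k2) | x <- times a2 b2 w.2].

Lemma two_arrivalsE w : two_arrivals w =
  zip (times a1 b1 w.1 ++ times a2 b2 w.2) (nseq (size w.1) k1 ++ nseq (size w.2) k2).
Proof.
rewrite /two_arrivals zip_cat ?size_nseq ?size_times//; congr (_ ++ _).
  by rewrite -(size_times a1 b1); elim: times => //= x s ->.
by rewrite -(size_times a2 b2); elim: times => //= x s ->.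
Qed.

(** The types always form a block of [k1] followed by a block of [k2], so any other [ks] gives the
    empty event. For such a [ks], the block lengths fix the two sample sizes, and the times are
    order statistics, which are measurable. *)
Lemma measurable_two_arrivals (ks : seq K) (A : set ((size ks).-tuple T)) :
  measurable A -> measurable [set w | exists2 t, A t & two_arrivals w = zip t ks].
Proof.
move=> mA; pose n1 := count_mem k1 ks; pose n2 := count_mem k2 ks.
have [ksE|ksN] := eqVneq ks (nseq n1 k1 ++ nseq n2 k2); last first.
  rewrite (_ : [set w | _] = set0)//; apply/seteqP; split=> w //= [t _].
  rewrite two_arrivalsE => /(congr1 unzip2).
  rewrite !unzip2_zip ?size_tuple ?size_cat ?size_nseq ?size_times// => ks'.
  move: ksN; rewrite /n1 /n2 -ks' !count_cat !count_nseq /= !eqxx.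
  by rewrite (negbTE k12) [k2 == k1]eq_sym (negbTE k12) !mul1n !mul0n addn0 add0n eqxx.
have sks : size ks = (n1 + n2)%N by rewrite ksE size_cat !size_nseq.
(* Defined for all samples so as to be measurable everywhere; it is the vector of arrival times only
   when the sample sizes are [n1] and [n2]. *)
pose phi (w : seqm T * seqm T) : (size ks).-tuple T :=
  [tuple if (i < n1)%N then nth 0 (times a1 b1 w.1) i
         else nth 0 (times a2 b2 w.2) (i - n1) | i < size ks].
have mphi : measurable_fun setT phi.
  apply/measurable_fun_tnthP => i.
  rewrite (_ : _ \o _ = fun w : seqm T * seqm T =>
    if (i < n1)%N then nth 0 (times a1 b1 w.1) i
         else nth 0 (times a2 b2 w.2) (i - n1)); last first.
    by apply/funext => w; rewrite /= tnth_mktuple.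
  case: (i < n1)%N.
    exact: (measurableT_comp (measurable_nth_times a1 b1 i) measurable_fst).
  exact: (measurableT_comp (measurable_nth_times a2 b2 (i - n1)) measurable_snd).
have phiE w : size w.1 = n1 -> size w.2 = n2 ->
    phi w = times a1 b1 w.1 ++ times a2 b2 w.2 :> seq R.
  move=> s1 s2; apply: (@eq_from_nth _ 0).
    by rewrite size_tuple size_cat !size_times s1 s2.
  move=> i; rewrite size_tuple => ik.
  rewrite -(tnth_nth _ _ (Ordinal ik)) tnth_mktuple nth_cat size_times s1 /=.
  by [].
rewrite (_ : [set w | _] =
  ([set s | size s = n1] `*` [set s | size s = n2]) `&` (phi @^-1` A)).
  apply: measurableI; first by apply: measurableX; exact: measurable_size.
  by rewrite -[X in measurable X]setTI; exact: mphi.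
apply/seteqP; split=> w /= => [[t At]|[[s1 s2] Aw]].
  rewrite two_arrivalsE => wE.
  have sz : size (times a1 b1 w.1 ++ times a2 b2 w.2) = (size w.1 + size w.2)%N.
    by rewrite size_cat !size_times.
  have := congr1 unzip2 wE; have := congr1 unzip1 wE.
  rewrite !unzip1_zip ?unzip2_zip ?sz ?size_tuple ?size_cat ?size_nseq// => tE ks'.
  have s1 : size w.1 = n1.
    by rewrite /n1 -ks' count_cat !count_nseq /= eqxx eq_sym (negbTE k12) mul1n addn0.
  have s2 : size w.2 = n2.
    by rewrite /n2 -ks' count_cat !count_nseq /= eqxx (negbTE k12) mul1n.
  by split=> //; rewrite (_ : phi w = t)//; apply: val_inj; rewrite /= -tE -phiE.
exists (phi w) => //; rewrite two_arrivalsE phiE// s1 s2.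
by congr zip.
Qed.

End Arr.

(** * Poisson counts of uniform times *)

Section UniformTimes.
Context (R : realType) (a b : R) (ab : a < b).
Notation T := (measurableTypeR R).
Notation U := (uniform_prob ab).
Variables (mu : R) (mu0 : 0 <= mu).

(** The uniform law is carried by [[a, b]], where [clamp] is the identity. *)
Lemma uniform_clamp (B : set T) : measurable B -> U (clamp a b @^-1` B) = U B.
Proof.
move=> mB; rewrite /uniform_prob integral_uniform_pdf [RHS]integral_uniform_pdf.
congr (integral _ _ _); apply/seteqP.
have clampE x : `[a, b]%classic x -> clamp a b x = x.
  by move=> /= xab; rewrite clamp_id.
by split=> x [Bx /[dup] xab /clampE xE]; split=> //; move: Bx; rewrite /= xE.
Qed.

(** Sorting preserves counts, and the preimages under [clamp] of successive half-open intervals are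
    disjoint, so [poisson_law_disjoint_counts] applies to them. *)
Lemma poisson_times_counts m (t : nat -> R) (c : 'I_m -> nat) :
  (forall i, (i < m)%N -> t i <= t i.+1) ->
  poisson_law U mu0 [set s | forall i : 'I_m,
    count (fun x => t i < x <= t i.+1) (times a b s) = c i] =
  (\prod_(i < m) poisson_mass (mu * fine (U `]t i, t i.+1])) (c i))%:E.
Proof.
move=> tle; pose B (i : 'I_m) : set T := clamp a b @^-1` `]t i, t i.+1].
have mB i : measurable (B i).
  by rewrite -[X in measurable X]setTI; apply: measurable_clamp.
have t_mono i j : (i <= j)%N -> (j <= m)%N -> t i <= t j.
  elim: j => [|j IH]; first by rewrite leqn0 => /eqP ->.
  rewrite leq_eqVlt => /predU1P[->//|ij jm].
  exact: le_trans (IH ij (ltnW jm)) (tle _ jm).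
have tB : trivIset setT B.
  suff H (i j : 'I_m) : (i < j)%N -> B i `&` B j = set0.
    apply/trivIsetP => i j _ _; rewrite neq_ltn => /orP[/H//|/H].
    by rewrite setIC.
  move=> ij; apply/seteqP; split=> x // [].
  rewrite /B/= !in_itv/= => /andP[_ xi] /andP[jx _]; have := lt_le_trans jx xi.
  by rewrite ltNge t_mono// ltnW.
transitivity (\prod_(i < m) poisson_mass (mu * fine (U (B i))) (c i))%:E; last first.
  by congr EFin; apply: eq_bigr => i _; rewrite uniform_clamp.
rewrite -poisson_law_disjoint_counts//; congr (_ _).
apply/seteqP; split=> s /= sc i; rewrite -sc ?count_times.
  by apply: eq_count => x /=; apply/idP/idP; rewrite inE /B/= in_itv.
by apply: eq_count => x /=; apply/idP/idP; rewrite inE /B/= in_itv.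
Qed.

End UniformTimes.

(** * The hard instance and its policies *)

Section HardInstance.
Context (R : realType).
Variables (mean r : 'I_2 -> R).
Hypotheses (mean_ge0 : forall k, 0 <= mean k) (r_ge0 : forall k, 0 <= r k).

Definition early : 'I_2 := ord0.
Definition late : 'I_2 := ord_max.

Definition lo (k : 'I_2) : R := if k == early then 4^-1 else 3 / 4.
Definition hi (k : 'I_2) : R := if k == early then 2^-1 else 1.

Lemma lo_gt0 k : 0 < lo k.
Proof. by rewrite /lo; case: ifP => _; lra. Qed.

Lemma lo_lt_hi k : lo k < hi k.
Proof. by rewrite /lo /hi; case: ifP => _; lra. Qed.

Lemma hi_le1 k : hi k <= 1.
Proof. by rewrite /hi; case: ifP => _; lra. Qed.

(** Constant on the window of type [k] and zero elsewhere, scaled so that [mean k] is the expected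
    number of arrivals of that type. *)
Definition window_rate (k : 'I_2) (t : R) : R :=
  mean k * uniform_pdf (lo k) (hi k) t.

Definition own_choice (k : 'I_2) (S : assortment 2) (n : alternative 2) : R :=
  if Some k \in S then (n == Some k)%:R else (n == None)%:R.

Lemma own_choice_sum k (S : assortment 2) (f : alternative 2 -> R) :
  None \in S -> \sum_(n in S) own_choice k S n * f n =
  if Some k \in S then f (Some k) else f None.
Proof.
move=> S0; rewrite /own_choice; case: ifP => Sk.
  rewrite (bigD1 (Some k))//= eqxx mul1r big1 ?addr0// => n /andP[_ /negbTE ->].
  by rewrite mul0r.
rewrite (bigD1 None)//= mul1r big1 ?addr0// => n /andP[_ /negbTE ->].
by rewrite mul0r.
Qed.

Lemma window_rate_ge0 k (t : R) : 0 <= t <= 1 -> 0 <= window_rate k t.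
Proof. by move=> _; rewrite mulr_ge0// uniform_pdf_ge0// lo_lt_hi. Qed.

Lemma window_rate_integrable k :
  (@lebesgue_measure R).-integrable `[0, 1] (fun t => (window_rate k t)%:E).
Proof.
apply: (integrableS measurableT) => //.
rewrite (_ : (fun t => _) =
  (fun t => (mean k)%:E * (uniform_pdf (lo k) (hi k) t)%:E)%E)//.
by apply: integrableZl => //; exact: integrable_uniform_pdf (lo_lt_hi k).
Qed.

Lemma own_choice_ge0 k (S : assortment 2) n :
  None \in S -> n \in S -> 0 <= own_choice k S n.
Proof. by move=> _ _; rewrite /own_choice; case: ifP => _; rewrite ler0n. Qed.

Lemma own_choice_sum1 k (S : assortment 2) :
  None \in S -> \sum_(n in S) own_choice k S n = 1.
Proof.
move=> S0; have := own_choice_sum k (fun=> 1) S0; rewrite if_same => <-.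
by apply: eq_bigr => n _; rewrite mulr1.
Qed.

(** The resource expires at time 1, so no time of the horizon comes later and the integral is over
    the empty set. *)
Lemma own_choice_expired k (l : 'I_1) :
  0 < \int[@lebesgue_measure R]_(t in `[0, 1] `&` `]1, +oo[) window_rate k t ->
  forall n (S : assortment 2), ord0 = l -> None \in S -> Some n \in S ->
  own_choice k S (Some n) = 0.
Proof.
rewrite (_ : `[0, 1]%classic `&` _ = set0) ?Rintegral_set0 ?ltxx//.
apply/seteqP; split=> x // [] /=; rewrite !in_itv/= andbT => /andP[_ x1].
by rewrite ltNge x1.
Qed.

Definition hard_instance : instance R :=
  @Instance R 1 2 2 (fun=> 1%N) (fun=> 1) (fun=> ord0) r window_rate own_choice
    r_ge0 window_rate_ge0 window_rate_integrable own_choice_ge0 own_choice_sum1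
    own_choice_expired.

Notation I := hard_instance.

Definition available (h : outcomes I) : bool := (0 < @remaining R I h ord0)%N.

Lemma available_rcons (h : outcomes I) S n :
  available (rcons h (S, n)) = available h && (n == None).
Proof.
rewrite /available /remaining /= -cats1 count_cat /= addn0.
by case: n => [n|]/=; rewrite ?eqxx/= ?andbF ?andbT ?addn0 ?addn1// subSS sub0n.
Qed.

Lemma feasible_sold (h : outcomes I) S : @feasible R I h S -> ~~ available h ->
  forall n, Some n \notin S.
Proof.
move=> /andP[_ /forallP hS] hN n; apply/negP => Sn.
by have := hS n; rewrite Sn/=; apply/negP.
Qed.

(** * Bounds for arbitrary and for online policies *)

Section Policy.
Variables (q : decision_rule I) (qP : is_policy q).

(** The offer determines the choice, so the inner sum collapses. Assortments of probability 0 are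
    set aside first, since it is feasibility that puts [None] in [S]. *)
Lemma reward_to_go_cons w h x u : reward_to_go q w h (x :: u) =
  \sum_S q w h S * (if Some x.2 \in S
    then r x.2 + reward_to_go q w (rcons h (S, Some x.2)) u
    else reward_to_go q w (rcons h (S, None)) u).
Proof.
apply: eq_bigr => S _; have [->|qS] := eqVneq (q w h S) 0; first by rewrite !mul0r.
congr (_ * _).
rewrite [LHS](own_choice_sum x.2
  (fun n => @reward_of R I n + reward_to_go q w (rcons h (S, n)) u)).
  by case: ifP => _ //=; rewrite add0r.
by have /andP[] := policy_feasible qP qS.
Qed.

Lemma reward_to_go_nil w h : reward_to_go q w h [::] = 0.
Proof. by []. Qed.

Local Arguments reward_to_go : simpl never.

Lemma policy_average_le w (h : outcomes I) (f g : assortment 2 -> R) :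
  (forall S, @feasible R I h S -> f S <= g S) ->
  \sum_S q w h S * f S <= \sum_S q w h S * g S.
Proof.
move=> fg; apply: ler_sum => S _; have [->|qS] := eqVneq (q w h S) 0.
  by rewrite !mul0r.
by rewrite ler_wpM2l ?(policy_ge0 qP)// fg// (policy_feasible qP qS).
Qed.

Lemma policy_average_cst w h (c : R) : \sum_S q w h S * c = c.
Proof. by rewrite -mulr_suml (policy_sum1 qP) mul1r. Qed.

Lemma reward_to_go_ge0 w h u : 0 <= reward_to_go q w h u.
Proof.
elim: u h => [|x u IH] h; first by rewrite reward_to_go_nil.
rewrite reward_to_go_cons; apply: sumr_ge0 => S _; rewrite mulr_ge0 ?(policy_ge0 qP)//.
by case: ifP => _ //; rewrite addr_ge0.
Qed.

Lemma reward_to_go_sold w h u : ~~ available h -> reward_to_go q w h u = 0.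
Proof.
elim: u h => [|x u IH] h hN //; apply/eqP; rewrite eq_le reward_to_go_ge0 andbT.
rewrite reward_to_go_cons -[leRHS](policy_average_cst w h).
apply: policy_average_le => S hS; rewrite (negbTE (feasible_sold hS hN _)).
by rewrite IH// available_rcons (negbTE hN).
Qed.

(** There is a single unit: the first sale earns [r k] and ends all further reward. *)
Lemma reward_to_go_le k w h u : all (fun x => x.2 == k) u ->
  reward_to_go q w h u <= r k.
Proof.
elim: u h => [|x u IH] h /=; first by rewrite reward_to_go_nil.
move=> /andP[/eqP xk uk]; rewrite reward_to_go_cons -[leRHS](policy_average_cst w h).
apply: policy_average_le => S hS; case: ifP => _; last exact: IH.
by rewrite xk reward_to_go_sold ?addr0// available_rcons andbF.
Qed.

Hypothesis qN : nonanticipating q.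
Hypothesis r_early : r early = 1.

(* Nonanticipation makes the behaviour towards the early customers, hence the
   probability [reward_to_go q (w ++ u) h u] of selling to one of them,
   independent of [v]. *)
Lemma online_reward_le w h u v : size h = size w ->
  all (fun x => x.2 == early) u -> all (fun x => x.2 == late) v ->
  reward_to_go q (w ++ u ++ v) h (u ++ v) <=
  reward_to_go q (w ++ u) h u +
  (1 - reward_to_go q (w ++ u) h u) * (r late * (v != [::])%:R).
Proof.
move=> + + vl; set beta := r late * _; elim: u w h => [|x u IH] w h hw.
  move=> _; rewrite !cats0 reward_to_go_nil add0r subr0 mul1r /beta.
  case: v vl @beta => [|y v] vl ? /=.
    by rewrite reward_to_go_nil mulr0.
  rewrite mulr1; exact: reward_to_go_le.
move=> /= /andP[/eqP xe ue].
rewrite !reward_to_go_cons; set Y := (leRHS in _ <= leRHS).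
(* As [size h = size w], the current customer is [x], and the two arrival lists agree up to and
   including [x]. *)
have qE S : q (w ++ x :: u ++ v) h S = q (w ++ x :: u) h S.
  apply: qN; rewrite hw -!cat_rcons !take_cat size_rcons ltnn subnn !take0.
  by case: (u).
under eq_bigr do rewrite qE.
pose y (S : assortment 2) := if Some x.2 \in S
    then r x.2 + reward_to_go q (w ++ x :: u) (rcons h (S, Some x.2)) u
    else reward_to_go q (w ++ x :: u) (rcons h (S, None)) u.
(* The bound is affine in the early reward and the offer probabilities sum to 1, so it suffices to
   compare assortment by assortment. If [x] buys, [y S = 1] and the term in [beta] vanishes;
   otherwise the induction hypothesis applies with [x] moved to the past. *)
rewrite {}/Y -/y (_ : _ + _ = \sum_S q (w ++ x :: u) h S * (y S + (1 - y S) * beta)).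
  apply: policy_average_le => S hS; rewrite /y; case: ifP => _.
    by rewrite !reward_to_go_sold ?available_rcons ?andbF// xe r_early; lra.
  have := IH (rcons w x) (rcons h (S, None)).
  by rewrite !size_rcons hw !cat_rcons; apply.
have -> : \sum_S q (w ++ x :: u) h S * (y S + (1 - y S) * beta) =
  \sum_S (q (w ++ x :: u) h S * y S * (1 - beta) + q (w ++ x :: u) h S * beta).
  by apply: eq_bigr => S _; ring.
by rewrite big_split/= policy_average_cst -mulr_suml; ring.
Qed.

End Policy.

(** * A clairvoyant policy *)

Section Offline.
Local Arguments reward_to_go : simpl never.

Definition offline_offer (w : arrivals R I) (h : outcomes I) : assortment 2 :=
  if available h then
    [set None; Some (if has (fun x => x.2 == late) w then late else early)]%SET
  else [set None]%SET.

Definition offline_rule : decision_rule I :=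
  fun w h S => (S == offline_offer w h)%:R.

Lemma offline_average w h (f : assortment 2 -> R) :
  \sum_S offline_rule w h S * f S = f (offline_offer w h).
Proof.
rewrite (bigD1 (offline_offer w h))//= /offline_rule eqxx mul1r big1 ?addr0//.
by move=> S /negbTE ->; rewrite mul0r.
Qed.

Lemma offline_rule_is_policy : is_policy offline_rule.
Proof.
split=> [w h S|w h|w h S|ks h S].
- exact: ler0n.
- rewrite -[RHS](offline_average w h (fun=> 1)).
  by apply: eq_bigr => S _; rewrite mulr1.
- rewrite /offline_rule; have [->|SN] := eqVneq S (offline_offer w h); last first.
    by rewrite mulr0n eqxx.
  move=> _.
  rewrite /feasible /offline_offer; case: ifP => av; rewrite !inE eqxx/=.
    by apply/forallP => n; apply/implyP => _; move: av; rewrite /available.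
  by apply/forallP => n; rewrite !inE.
- rewrite /offline_rule /offline_offer.
  (* The presence of a late customer can be read off the types [ks] alone, so the rule is constant
     in the times. *)
  under eq_fun => t.
    rewrite (_ : has _ _ = has (fun k => k == late) ks); last first.
      by rewrite -[in RHS](@unzip2_zip _ _ t ks) ?size_tuple// has_map.
    over.
  exact: measurable_cst.
Qed.

(** The early customers in [u] are offered only the late product and leave without buying, so the
    unit is still there for [y]. *)
Lemma offline_reward_late w h u y v : available h ->
  has (fun x => x.2 == late) w -> all (fun x => x.2 == early) u -> y.2 = late ->
  r late <= reward_to_go offline_rule w h (u ++ y :: v).
Proof.
move=> + wl + yl; elim: u h => [|x u IH] h av.
  move=> _; rewrite reward_to_go_cons; last exact: offline_rule_is_policy.
  rewrite offline_average /offline_offer av wl yl !inE eqxx orbT lerDl.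
  exact: (reward_to_go_ge0 offline_rule_is_policy).
move=> /= /andP[/eqP xe ue].
rewrite reward_to_go_cons; last exact: offline_rule_is_policy.
rewrite offline_average /offline_offer av wl xe !inE /=.
by rewrite IH// available_rcons av.
Qed.

Lemma offline_total_reward u v :
  all (fun x => x.2 == early) u -> all (fun x => x.2 == late) v ->
  r late * (v != [::])%:R + r early * ((u != [::]) && (v == [::]))%:R <=
  total_reward offline_rule (u ++ v).
Proof.
have av0 : available [::] by [].
move=> ue; case: v => [_|y v /= /andP[/eqP yl _]]; last first.
  rewrite andbF mulr0 addr0 mulr1; apply: offline_reward_late => //.
  by rewrite has_cat/= yl eqxx orbT.
rewrite cats0 mulr0 add0r andbT; case: u ue => [|x u] /=; first by rewrite mulr0.
move=> /andP[/eqP xe ue]; rewrite mulr1 /total_reward.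
rewrite reward_to_go_cons; last exact: offline_rule_is_policy.
rewrite offline_average /offline_offer av0 /= xe /=.
rewrite (_ : has _ _ = false); last first.
  by apply/negbTE; rewrite -all_predC; apply: sub_all ue => z /= /eqP ->.
rewrite !inE eqxx orbT lerDl.
exact: (reward_to_go_ge0 offline_rule_is_policy).
Qed.

End Offline.
End HardInstance.

(** * Arrivals of the hard instance *)

Section HardArrivals.
Context (R : realType).
Variables (mean r : 'I_2 -> R).
Hypotheses (mean_ge0 : forall k, 0 <= mean k) (r_ge0 : forall k, 0 <= r k).
Notation T := (measurableTypeR R).
Notation I := (hard_instance mean_ge0 r_ge0).

Definition window_prob k : probability T R := uniform_prob (lo_lt_hi R k).

Definition window_law k : probability (seqm T) R :=
  poisson_law (window_prob k) (mean_ge0 k).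

Definition hard_law : probability (seqm T * seqm T)%type R :=
  (window_law early \x window_law late)%E.

Definition hard_arrivals (w : seqm T * seqm T) : arrivals R I :=
  two_arrivals (lo R early) (hi R early) (lo R late) (hi R late) early late w.

Definition sample (k : 'I_2) (w : seqm T * seqm T) : seqm T :=
  if k == early then w.1 else w.2.

Definition window_times k (s : seqm T) : seq R := times (lo R k) (hi R k) s.

Lemma window_mean k (s t : R) :
  \int[@lebesgue_measure R]_(u in `]s, t]) window_rate mean k u =
  mean k * fine (window_prob k `]s, t]%classic).
Proof.
rewrite /Rintegral; under eq_integral do rewrite EFinM.
rewrite integralZl//; last first.
  apply: (integrableS measurableT) => //.
  exact: integrable_uniform_pdf (lo_lt_hi R k).
have fin : window_prob k `]s, t]%classic \is a fin_num by exact: fin_num_measure.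
by rewrite fineM.
Qed.

Lemma nb_arrivals_hard k s t w : @nb_arrivals R I k s t (hard_arrivals w) =
  count (fun x => s < x <= t) (window_times k (sample k w)).
Proof.
rewrite /nb_arrivals /hard_arrivals /two_arrivals count_cat !count_map.
rewrite /sample /window_times.
have [->|kN] := eqVneq k early.
  rewrite [X in (_ + X)%N](_ : _ = 0%N) ?addn0; last first.
    by rewrite (eq_count (a2 := pred0)) ?count_pred0//.
  by apply: eq_count => x /=; rewrite ?eqxx.
have -> : k = late by apply/val_inj; case: k kN => -[|[|]].
rewrite [X in (X + _)%N](_ : _ = 0%N) ?add0n; last first.
  by rewrite (eq_count (a2 := pred0)) ?count_pred0//.
by apply: eq_count => x /=; rewrite ?eqxx.
Qed.

Lemma big_two_types (V : Type) (idx : V) (op : Monoid.law idx) (F : 'I_2 -> V) :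
  \big[op/idx]_k F k = op (F early) (F late).
Proof.
rewrite big_ord_recl big_ord1; congr (op _ (F _)); exact: val_inj.
Qed.

Lemma hard_law_rect (A B : set (seqm T)) : measurable A -> measurable B ->
  hard_law [set w | A w.1 /\ B w.2] = (window_law early A * window_law late B)%E.
Proof.
move=> mA mB; rewrite (_ : [set w | _] = A `*` B)//.
exact: product_measure1E.
Qed.

Lemma hard_law_sample k (A : set (seqm T)) : measurable A ->
  hard_law [set w | A (sample k w)] = window_law k A.
Proof.
move=> mA; rewrite /sample; have [->|kN] := eqVneq k early.
  rewrite (_ : [set w | _] = [set w | A w.1 /\ setT w.2]).
    by rewrite hard_law_rect// probability_setT mule1.
  by apply/seteqP; split=> w //= [].
have -> : k = late by apply/val_inj; case: k kN => -[|[|]].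
rewrite (_ : [set w | _] = [set w | setT w.1 /\ A w.2]).
  by rewrite hard_law_rect// probability_setT mul1e.
by apply/seteqP; split=> w //= [].
Qed.

Lemma measurable_window_counts k m (t : nat -> R) (c : 'I_m -> nat) :
  measurable [set s : seqm T | forall i : 'I_m,
    count (fun x => t i < x <= t i.+1) (window_times k s) = c i].
Proof.
apply: measurable_forall => i.
rewrite (_ : (fun s => _) = [set s : seqm T | count ((fun x => t i < x <= t i.+1) \o
   clamp (lo R k) (hi R k)) s = c i]); last first.
  by apply/seteqP; split=> s /=; rewrite count_times.
apply: measurable_count.
rewrite (_ : [set x | _] =
    clamp (lo R k) (hi R k) @^-1` `]t i, t i.+1]%classic); last first.
  by apply/seteqP; split=> x /=; rewrite in_itv.
by rewrite -[X in measurable X]setTI; apply: measurable_clamp.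
Qed.

Lemma hard_poisson k (s t : R) (c : nat) : s <= t ->
  hard_law [set w | @nb_arrivals R I k s t (hard_arrivals w) = c] =
  (poisson_mass (mean k * fine (window_prob k `]s, t]%classic)) c)%:E.
Proof.
(* The subdivision with the single interval from [s] to [t], for [poisson_times_counts] with one
   count. *)
move=> st; pose g i := if i is 0%N then s else t.
have gle i : (i < 1)%N -> g i <= g i.+1 by case: i.
have := poisson_times_counts (lo_lt_hi R k) (mean_ge0 k) (fun=> c) gle.
rewrite big_ord1 => <-; rewrite -/(window_prob k) -/(window_law k).
rewrite -hard_law_sample; last exact: measurable_window_counts.
congr (hard_law _); apply/seteqP; split=> w /=; rewrite nb_arrivals_hard.
  by move=> wc i; rewrite (ord1 i).
by move=> /(_ ord0).
Qed.

Lemma hard_arrivals_poisson : poisson_arrivals hard_law hard_arrivals.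
Proof.
split.
- move=> w; rewrite all_cat !all_map; apply/andP.
  split; apply: sub_all (times_itv _ (ltW (lo_lt_hi R _))) => x /= /andP[lx xh].
    by rewrite (lt_le_trans (lo_gt0 R early) lx) (le_trans xh (hi_le1 R early)).
  by rewrite (lt_le_trans (lo_gt0 R late) lx) (le_trans xh (hi_le1 R late)).
- move=> w; rewrite map_cat -!map_comp.
  rewrite (eq_map (g := id)) ?map_id//.
  rewrite sorted_pairwise ?pairwise_cat; last exact: le_trans.
  rewrite -!sorted_pairwise ?times_sorted ?andbT; try exact: le_trans.
  (* Every early time is at most [1/2] and every late time at least [3/4]. *)
  apply/allrelP => x y /(allP (times_itv _ (ltW (lo_lt_hi R _)))) /andP[_ xh].
  move=> /(allP (times_itv _ (ltW (lo_lt_hi R _)))) /andP[ly _].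
  apply: le_trans xh (le_trans _ ly); rewrite /hi /lo /=; lra.
- by move=> ks A mA; exact: measurable_two_arrivals.
- by move=> k s t c _ st _; rewrite hard_poisson// window_mean.
- move=> m t c _ tle _.
  (* The two types read different coordinates of [w], so the event is a rectangle. The product
     measure factors it over the types, and [poisson_times_counts] factors each side over the
     intervals. *)
  rewrite (_ : [set w | _] =
    [set w | [set s | forall i : 'I_m,
      count (fun x => t i < x <= t i.+1) (window_times early s) = c early i] w.1 /\
      [set s | forall i : 'I_m,
      count (fun x => t i < x <= t i.+1) (window_times late s) = c late i] w.2]); last first.
    apply/seteqP; split=> w /=.
      by move=> H; split=> i; [have := H early i|have := H late i];
        rewrite nb_arrivals_hard.
    move=> [He Hl] k i; rewrite nb_arrivals_hard.
    have [->|kN] := eqVneq k early; first exact: He.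
    have -> : k = late by apply/val_inj; case: k kN => -[|[|]].
    exact: Hl.
  rewrite hard_law_rect; [|exact: measurable_window_counts..].
  rewrite [RHS](big_two_types _ (fun k => _)).
  have H k : window_law k [set s | forall i : 'I_m,
      count (fun x => t i < x <= t i.+1) (window_times k s) = c k i] =
    (\prod_(i < m) hard_law
       [set w | @nb_arrivals R I k (t i) (t i.+1) (hard_arrivals w) = c k i])%E.
    rewrite [LHS](poisson_times_counts (lo_lt_hi R k) (mean_ge0 k) (c k) tle).
    rewrite -prodEFin; apply: eq_bigr => i _.
    by rewrite hard_poisson// tle.
  by rewrite !H.
Qed.

End HardArrivals.

(** * Values of the policies *)

Section TotalRewardMeasurable.
Context (R : realType) (I : instance R).
Variables (q : decision_rule I) (qP : is_policy q).

(** Decisions read the times from [w]; the list being traversed contributes only its types. *)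
Lemma eq_reward_to_go w h (u u' : arrivals R I) : unzip2 u = unzip2 u' ->
  reward_to_go q w h u = reward_to_go q w h u'.
Proof.
elim: u u' h => [|x u IH] [|x' u'] h //= [xx' uu']; apply: eq_bigr => S _.
by congr (_ * _); apply: eq_bigr => n _; rewrite xx' (IH u').
Qed.

Lemma measurable_reward_to_go (ks : seq 'I_(ntype I)) h (u : arrivals R I) :
  measurable_fun [set: (size ks).-tuple (measurableTypeR R)]
    (fun t : (size ks).-tuple (measurableTypeR R) => reward_to_go q (zip t ks) h u).
Proof.
elim: u h => [|x u IH] h /=; first exact: measurable_cst.
apply: measurable_sum => S; apply: measurable_funM; first exact: policy_measurable.
under eq_fun do rewrite big_mkcond; apply: measurable_sum => n.
case: (n \in S); last exact: measurable_cst.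
apply: measurable_funM; first exact: measurable_cst.
by apply: measurable_funD; [exact: measurable_cst|exact: IH].
Qed.

(** There are countably many type sequences, and for each of them the reward is a measurable
    function of the times. *)
Lemma measurable_total_reward d (Omega : measurableType d) (P : probability Omega R)
    (arr : Omega -> arrivals R I) : poisson_arrivals P arr ->
  measurable_fun setT (fun w => total_reward q (arr w)).
Proof.
move=> arrP _ Y mY; rewrite setTI.
rewrite (_ : _ @^-1` Y = \bigcup_(ks in [set: seq 'I_(ntype I)])
  [set w | exists2 t : (size ks).-tuple (measurableTypeR R),
     Y (total_reward q (zip t ks)) & arr w = zip t ks]).
  apply: countable_bigcupT_measurable => [|ks]; first exact: countableP.
  (* The traversed list gets dummy times 0, because [measurable_reward_to_go] keeps it fixed while
     [t] varies. *)
  apply: (arr_measurable arrP); rewrite [X in measurable X](_ : _ =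
    setT `&` (fun t : (size ks).-tuple (measurableTypeR R) =>
      reward_to_go q (zip t ks) [::] (zip (nseq (size ks) 0) ks)) @^-1` Y).
    exact: measurable_reward_to_go.
  rewrite setTI; apply/seteqP; split=> t /=; rewrite /total_reward.
    rewrite (@eq_reward_to_go _ _ (zip (nseq (size ks) 0) ks) (zip t ks))//.
    by rewrite !unzip2_zip ?size_nseq ?size_tuple.
  rewrite (@eq_reward_to_go _ _ (zip t ks) (zip (nseq (size ks) 0) ks))//.
  by rewrite !unzip2_zip ?size_nseq ?size_tuple.
apply/seteqP; split=> w /= => [Yw|[ks _ [t Yt wE]]]; last by rewrite wE.
have st : size (unzip1 (arr w)) == size (unzip2 (arr w)) by rewrite !size_map.
by exists (unzip2 (arr w)) => //; exists (Tuple st) => /=; rewrite zip_unzip.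
Qed.

End TotalRewardMeasurable.

Lemma integral_two_indic d (T : measurableType d) (R : realType)
    (m : {measure set T -> \bar R}) (c1 c2 : R) (A1 A2 : set T) :
  0 <= c1 -> 0 <= c2 -> measurable A1 -> measurable A2 ->
  (\int[m]_x (c1 * \1_A1 x + c2 * \1_A2 x)%:E = c1%:E * m A1 + c2%:E * m A2)%E.
Proof.
move=> c10 c20 mA1 mA2; under eq_integral do rewrite EFinD !EFinM.
rewrite ge0_integralD//; last 4 first.
- by move=> x _; rewrite -EFinM lee_fin mulr_ge0.
- by apply/measurable_EFinP; apply: measurable_funM => //; exact: measurable_indic.
- by move=> x _; rewrite -EFinM lee_fin mulr_ge0.
- by apply/measurable_EFinP; apply: measurable_funM => //; exact: measurable_indic.
rewrite !ge0_integralZl_EFin ?integral_indic ?setIT//;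
  by apply/measurable_EFinP; exact: measurable_indic.
Qed.

Section Values.
Context (R : realType) (delta : R).
Hypotheses (delta_gt0 : 0 < delta) (delta_lt1 : delta < 1).
Notation T := (measurableTypeR R).

(* The early window is empty with probability [delta], the late one with
   probability [1 - delta]. *)
Definition hard_mean (k : 'I_2) : R :=
  if k == early then - ln delta else - ln (1 - delta).

Definition hard_reward (k : 'I_2) : R := if k == early then 1 else delta^-1.

Lemma hard_mean_ge0 k : 0 <= hard_mean k.
Proof.
rewrite /hard_mean; case: ifP => _; rewrite oppr_ge0 ln_le0//.
  exact: ltW.
rewrite gerBl; exact: ltW.
Qed.

Lemma hard_reward_ge0 k : 0 <= hard_reward k.
Proof. by rewrite /hard_reward; case: ifP => _; rewrite ?invr_ge0// ltW. Qed.

Notation I := (hard_instance hard_mean_ge0 hard_reward_ge0).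
Notation law := (window_law hard_mean_ge0).

Definition nonempty : set (seqm T) := ~` [set [::]].

Lemma measurable_nil : measurable ([set [::]] : set (seqm T)).
Proof.
rewrite (_ : [set [::]] = [set s : seqm T | size s = 0%N]).
  exact: measurable_size.
by apply/seteqP; split=> s /= => [->//|/size0nil].
Qed.

Lemma measurable_nonempty : measurable nonempty.
Proof. exact: measurableC measurable_nil. Qed.

Lemma early_nil : law early [set [::]] = delta%:E.
Proof. by rewrite [LHS]poisson_law_nil /hard_mean eqxx opprK lnK. Qed.

Lemma late_nil : law late [set [::]] = (1 - delta)%:E.
Proof. by rewrite [LHS]poisson_law_nil /hard_mean /= opprK lnK// posrE subr_gt0. Qed.

Lemma early_nonempty : law early nonempty = (1 - delta)%:E.
Proof. by rewrite probability_setC ?early_nil//; exact: measurable_nil. Qed.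

Lemma late_nonempty : law late nonempty = delta%:E.
Proof.
rewrite probability_setC ?late_nil//; last exact: measurable_nil.
by rewrite -EFinB; congr EFin; ring.
Qed.

Let arr := @hard_arrivals R hard_mean hard_reward hard_mean_ge0 hard_reward_ge0.
Let P := hard_law hard_mean_ge0.

Let early_part (s : seqm T) : arrivals R I :=
  [seq (x, early) | x <- window_times early s].
Let late_part (s : seqm T) : arrivals R I :=
  [seq (x, late) | x <- window_times late s].

Let early_part_nil s : (early_part s != [::]) = (s != [::]).
Proof. by rewrite -!size_eq0 size_map size_times. Qed.

Let late_part_nil s : (late_part s != [::]) = (s != [::]).
Proof. by rewrite -!size_eq0 size_map size_times. Qed.

Let indic_nonempty s : \1_nonempty s = (s != [::])%:R :> R.
Proof.
rewrite indicE; have [->|/eqP sN] := eqVneq s [::]; last by rewrite mem_set.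
by rewrite memNset//; apply.
Qed.

Let early_part_early s : all (fun x => x.2 == early) (early_part s).
Proof. by rewrite all_map; apply/allP. Qed.

Let late_part_late s : all (fun x => x.2 == late) (late_part s).
Proof. by rewrite all_map; apply/allP. Qed.

(** By Tonelli, the early sample can be fixed and the late one averaged first. If [Y] is the
    resulting chance of an early sale, the average is at most
    [Y + (1 - Y) * delta^-1 * delta = 1]. *)
Lemma online_value_le (q : decision_rule I) : is_policy q -> nonanticipating q ->
  (value P arr q <= 1)%E.
Proof.
move=> qP qN.
have mf : measurable_fun setT (fun w => (total_reward q (arr w))%:E).
  apply/measurable_EFinP; apply: (@measurable_total_reward _ _ _ qP _ _ P).
  exact: hard_arrivals_poisson.
have f0 w : (0 <= (total_reward q (arr w))%:E)%E.
  by rewrite lee_fin; exact: reward_to_go_ge0.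
rewrite /value (_ : integral _ _ _ =
  \int[law early]_s \int[law late]_s' (total_reward q (arr (s, s')))%:E)%E; last first.
  exact: (fubini_tonelli1 (fun w => (total_reward q (arr w))%:E)).
have <- : (\int[law early]_s (cst 1 s) = 1)%E.
  by rewrite [LHS]integral_cst// mul1e; exact: probability_setT.
apply: ge0_le_integral => //.
- by move=> s _; apply: integral_ge0 => s' _.
- exact: (measurable_fun_fubini_tonelli_F (fun w => (total_reward q (arr w))%:E)).
move=> s _; pose Y := total_reward q (early_part s).
have Y0 : 0 <= Y by exact: reward_to_go_ge0.
have Y1 : Y <= 1.
  by have := reward_to_go_le qP (early_part s) [::] (early_part_early s).
(* The bound of [online_reward_le], with the constant [Y] carried by the indicator of the whole
   space to fit [integral_two_indic]. *)
apply: (@le_trans _ _ (\int[law late]_s'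
    (Y * \1_setT s' + ((1 - Y) * delta^-1) * \1_nonempty s')%:E)%E).
  apply: ge0_le_integral => //.
  - exact: measurableT_comp mf (pair1_measurable s).
  - apply/measurable_EFinP; apply: measurable_funD; apply: measurable_funM => //;
      by apply: measurable_indic => //; exact: measurable_nonempty.
  move=> s' _; rewrite lee_fin indicT mulr1 indic_nonempty -late_part_nil.
  rewrite -mulrA.
  exact: (@online_reward_le _ _ _ _ _ q qP qN erefl [::] [::] (early_part s)
    (late_part s') erefl (early_part_early s) (late_part_late s')).
rewrite integral_two_indic//; last 2 first.
- by rewrite mulr_ge0 ?subr_ge0// invr_ge0 ltW.
- exact: measurable_nonempty.
rewrite [leLHS](_ : _ = Y%:E * 1 + ((1 - Y) / delta)%:E * delta%:E)%E; last first.
  by congr (_ * _ + _ * _)%E; [exact: probability_setT|exact: late_nonempty].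
rewrite -!EFinM -EFinD lee_fin.
by rewrite mulr1 -mulrA mulVf ?gt_eqF//; lra.
Qed.

Lemma offline_value_ge :
  ((1 + (1 - delta) ^+ 2)%:E <= value_offline P arr)%E.
Proof.
pose q := @offline_rule R _ _ hard_mean_ge0 hard_reward_ge0.
have qP : is_policy q by exact: offline_rule_is_policy.
apply: (@le_trans _ _ (value P arr q)); last first.
  by apply: ereal_sup_ubound; exists (exist _ q qP).
(* [B1]: a late customer comes, with probability [delta] and reward [delta^-1]. [B2]: only early
   customers come, with probability [(1 - delta)^2] and reward 1. *)
pose B1 : set (seqm T * seqm T) := setT `*` nonempty.
pose B2 : set (seqm T * seqm T) := nonempty `*` [set [::]].
have mB1 : measurable B1 by apply: measurableX => //; exact: measurable_nonempty.
have mB2 : measurable B2.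
  by apply: measurableX; [exact: measurable_nonempty|exact: measurable_nil].
have <- : (\int[P]_w (delta^-1 * \1_B1 w + 1 * \1_B2 w)%:E =
    (1 + (1 - delta) ^+ 2)%:E)%E.
  rewrite integral_two_indic//; last by rewrite invr_ge0 ltW.
  transitivity ((delta^-1)%:E * (law early setT * law late nonempty) +
      1%:E * (law early nonempty * law late [set [::]]))%E.
    by congr (_ * _ + _ * _)%E; apply: product_measure1E => //;
      [exact: measurable_nonempty..|exact: measurable_nil].
  have -> : law early setT = 1%E by exact: probability_setT.
  rewrite late_nonempty early_nonempty late_nil.
  by rewrite mul1e -!EFinM -EFinD mul1r mulVf ?gt_eqF// expr2.
apply: ge0_le_integral => //.
- by move=> w _; rewrite lee_fin addr_ge0 ?mulr_ge0// invr_ge0 ltW.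
- apply/measurable_EFinP; apply: measurable_funD; apply: measurable_funM => //;
    exact: measurable_indic.
- apply/measurable_EFinP; apply: (@measurable_total_reward _ _ _ qP _ _ P).
  exact: hard_arrivals_poisson.
move=> [s s'] _; rewrite lee_fin.
have := @offline_total_reward R _ _ hard_mean_ge0 hard_reward_ge0 (early_part s)
  (late_part s') (early_part_early s) (late_part_late s').
apply: le_trans; rewrite late_part_nil early_part_nil /hard_reward /= lerD//.
  rewrite -indic_nonempty !indicE; suff -> : ((s, s') \in B1) = (s' \in nonempty) by [].
  by apply/idP/idP => /set_mem; [case=> _ ? | move=> ?]; exact: mem_set.
rewrite indicE; suff -> : ((s, s') \in B2) = (s != [::]) && (s' == [::]).
  by rewrite !mul1r -[late_part s' == _]negbK late_part_nil negbK.
apply/idP/andP => [/set_mem[/= sN s'0]|[/eqP sN /eqP s'0]].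
  by split; exact/eqP.
exact: mem_set.
Qed.

End Values.

Theorem theorem3 (R : realType) (alpha : R) (halpha : 1 / 2 < alpha)
  (A : online_algorithm R) : ~ competitive alpha A.
Proof.
move=> compA; have alpha0 : 0 < alpha by lra.
(* Chosen so that [2 * alpha * delta = alpha - 1/2]; then [alpha * (1 + (1 - delta)^2)] exceeds [2 *
   alpha - 2 * alpha * delta = alpha + 1/2], which is greater than 1. *)
pose delta := (2 * alpha - 1) / (4 * alpha).
have deltaE : delta * (4 * alpha) = 2 * alpha - 1.
  by rewrite /delta divfK// mulf_neq0 ?gt_eqF//; lra.
have d0 : 0 < delta by rewrite divr_gt0//; lra.
have d1 : delta < 1 by rewrite ltr_pdivrMr; lra.
pose I := hard_instance (hard_mean_ge0 d0 d1) (hard_reward_ge0 d0).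
have [qP qN] := svalP (A I).
have /= := compA I _ _ _ _
  (hard_arrivals_poisson (hard_mean_ge0 d0 d1) (hard_reward_ge0 d0)).
move=> /le_trans/(_ (online_value_le qP qN)); apply/negP; rewrite -ltNge.
apply: (@lt_le_trans _ _ (alpha%:E * (1 + (1 - delta) ^+ 2)%:E)%E).
  by rewrite -EFinM lte_fin; nra.
by rewrite lee_pmul2l// offline_value_ge.
Qed.
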